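(* Let $D_m=(X_1,\ldots,X_m)$ be i.i.d. observations from a distribution $P$, let $\theta_0=\phi(P)\in\mathbb R^d$ be a functional of $P$, $\widehat\theta_m=\phi(P_m)$ with $P_m$ the empirical distribution of $X_1,\ldots,X_m$, $S:\mathbb R^d\to\mathbb R$ a function, $\tau_m$ a normalizing sequence such that $S(\tau_m(\widehat\theta_m-\theta_0))$ converges in distribution as $m\to\infty$, and $S_m(\theta)=S(\tau_m(\widehat\theta_m-\theta))$. Draw $B$ subsamples $(X_1^{*b},\ldots,X_k^{*b})$, $b=1,\ldots,B$, of size $k$ from $D_m$; let $\widehat\theta_k^{*b}=\phi(P_k^{*b})$ with $P_k^{*b}$ the empirical distribution of the $b$-th subsample, and $W_b=S(\tau_k(\widehat\theta_k^{*b}-\widehat\theta_m))$, with order statistics $W_{(1)}\le\cdots\le W_{(B)}$. For $\alpha\in(0,1)$ define the modified subsampling confidence interval $$\mathrm{CI}=\Big\{\theta:\ S_m(\theta)\in\big[W_{(\lfloor(B+1)(\alpha/2)\rfloor)},\,W_{(\lceil(B+1)(1-\alpha)\rceil+\lfloor(B+1)(\alpha/2)\rfloor)}\big)\Big\}.$$ With $F_0(D_m)=\mathbb P(W_b\le S_m(\theta_0)\mid D_m)$, $$\Big|\mathbb P(\theta_0\in\mathrm{CI})-\frac{\lceil(B+1)(1-\alpha)\rceil}{B+1}\Big|\le\widetilde d_{\mathrm{KS}}(F_0(D_m),U(0,1)).$$ The bounds on coverage can be restated as $$-\widetilde d_{\mathrm{KS}}(F_0(D_m),U(0,1))\le\mathbb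 P(\theta_0\in\mathrm{CI})-(1-\alpha)\le\frac1{B+1}+\widetilde d_{\mathrm{KS}}(F_0(D_m),U(0,1)).$$
   Context: For real random variables, $\widetilde d_{\mathrm{KS}}(Y_1,Y_2)=\sup_{s,t\in\mathbb R}|\mathbb P(Y_1\in(s,t])-\mathbb P(Y_2\in(s,t])|$; $U(0,1)$ denotes a standard uniform random variable. The subsamples are drawn so that, conditionally on $D_m$, the variables $W_1,\ldots,W_B$ are independent and identically distributed; in particular $F_0(D_m)$ does not depend on $b$. The order statistic $W_{(0)}$ is set to be $\min\{w:w\in\mathcal W\}$, where $\mathcal W\subset\mathbb R$ is the space in which the $W_b$ take their values. The probability $\mathbb P(\theta_0\in\mathrm{CI})$ is over both the data and the subsampling. *)

(* Defs.v *)
From HB Require Import structures.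
From mathcomp Require Export all_boot all_order all_algebra.
From mathcomp Require Export all_classical all_reals all_analysis.

Export Order.TTheory GRing.Theory Num.Theory.
Export numFieldNormedType.Exports.

Set Implicit Arguments.
Unset Strict Implicit.
Unset Printing Implicit Defensive.

Global Open Scope classical_set_scope.
Global Open Scope ring_scope.

Section empirical.
Local Open Scope ereal_scope.
Context d (T : measurableType d) (R : realType) (n : nat).

(* The proof of [0 < n] only serves to make this a probability measure. *)
Definition empirical (n_gt0 : (0 < n)%N) (x : n.-tuple T) (A : set T) : \bar R :=
  (n%:R^-1)%:E * \sum_(i < n) \d_(tnth x i) A.

Variables (n_gt0 : (0 < n)%N) (x : n.-tuple T).

Let empirical0 : empirical n_gt0 x set0 = 0.
Proof. by rewrite /empirical big1 ?mule0// => i _; rewrite measure0. Qed.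

Let empirical_ge0 A : 0 <= empirical n_gt0 x A.
Proof.
by apply: mule_ge0; [rewrite lee_fin invr_ge0 | apply: sume_ge0 => i _].
Qed.

Let empirical_sigma_additive : semi_sigma_additive (empirical n_gt0 x).
Proof.
move=> F mF tF mUF.
suff -> : empirical n_gt0 x (\bigcup_i F i) = \sum_(0 <= i <oo) empirical n_gt0 x (F i).
  by apply: is_cvg_nneseries => i _ _.
rewrite nneseriesZl; last by move=> i _; apply: sume_ge0.
  rewrite nneseries_sum//; congr (_ * _); apply: eq_bigr => i _.
  by apply/esym/cvg_lim => //; exact: measure_semi_sigma_additive.
Qed.

HB.instance Definition _ := isMeasure.Build _ _ _ (empirical n_gt0 x)
  empirical0 empirical_ge0 empirical_sigma_additive.

Let empiricalT : empirical n_gt0 x setT = 1.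
Proof.
rewrite /empirical (eq_bigr (fun=> 1)) => [|i _]; last by rewrite diracT.
rewrite sumEFin sumr_const card_ord -EFinM mulVf// pnatr_eq0 -lt0n//.
Qed.

HB.instance Definition _ := Measure_isProbability.Build _ _ _
  (empirical n_gt0 x) empiricalT.

End empirical.

Section probability_notions.
Context dO (O : measurableType dO) (R : realType) (Pr : probability O R).

Definition mutually_independent dT (T : measurableType dT) (X : nat -> O -> T) :=
  forall (J : seq nat) (A : nat -> set T), uniq J ->
    (forall i, measurable (A i)) ->
    Pr (\bigcap_(i in [set` J]) X i @^-1` A i) =
    (\prod_(i <- J) Pr (X i @^-1` A i))%E.

Definition iid_from dT (T : measurableType dT) (P : probability T R)
    (X : nat -> {RV Pr >-> T}) :=
  mutually_independent (fun i => X i : O -> T) /\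
  forall i (A : set T), measurable A -> distribution Pr (X i) A = P A.

Definition cvg_in_distribution (Y : nat -> O -> R) :=
  exists L : probability R R,
    forall t : R, {for t, continuous (fun u : R => L [set x | x <= u])} ->
      Pr [set w | Y n w <= t] @[n --> \oo] --> L [set x | x <= t].

(* [f (D)] is a version of [Pr (A | D)]. Integrability of [f \o D] follows from
   the identity with C := [set x | 0 <= f x] and its complement. *)
Definition is_cond_prob dS (S : measurableType dS) (D : O -> S) (A : set O)
    (f : S -> R) :=
  measurable_fun setT f /\
  forall C : set S, measurable C ->
    (\int[Pr]_(w in D @^-1` C) (f (D w))%:E = Pr (A `&` D @^-1` C))%E.

(* The first clause says that the W b have a common conditional law given D,
   the second that they are conditionally independent given D. *)
Definition cond_iid dS (S : measurableType dS) (D : O -> S) (B : nat)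
    (W : 'I_B -> O -> R) :=
  (forall C : set R, measurable C ->
     exists q : S -> R, forall b, is_cond_prob D (W b @^-1` C) q) /\
  (forall (C : 'I_B -> set R) (q : 'I_B -> S -> R),
     (forall b, measurable (C b)) ->
     (forall b, is_cond_prob D (W b @^-1` C b) (q b)) ->
     is_cond_prob D (\bigcap_b W b @^-1` C b) (fun x => \prod_(b < B) q b x)).

End probability_notions.

Definition dKS (R : realType) d1 (O1 : measurableType d1) (P1 : probability O1 R)
    (Y1 : O1 -> R) d2 (O2 : measurableType d2) (P2 : probability O2 R)
    (Y2 : O2 -> R) : R :=
  sup [set r | exists s t : R,
    r = `|fine (P1 (Y1 @^-1` [set` `]s, t]])) - fine (P2 (Y2 @^-1` [set` `]s, t]]))| ].

Definition dKS_uniform (R : realType) d1 (O1 : measurableType d1)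
    (P1 : probability O1 R) (Y1 : O1 -> R) : R :=
  dKS P1 Y1 (uniform_prob (@ltr01 R)) (fun u : R => u).

Section subsampling.
Context d (T : measurableType d) (R : realType) (p : nat).
Variables (phi : probability T R -> 'rV[R]_p) (S : 'rV[R]_p -> R) (tau : nat -> R).

Definition estimator n (n_gt0 : (0 < n)%N) (x : n.-tuple T) : 'rV[R]_p :=
  phi (empirical R n_gt0 x).

Definition root_stat n (n_gt0 : (0 < n)%N) (x : n.-tuple T) (theta : 'rV[R]_p) : R :=
  S (tau n *: (estimator n_gt0 x - theta)).

(* The subsample of x selected by the indices j; repetitions are allowed, so
   that sampling with and without replacement are both covered. *)
Definition subsample m k (x : m.-tuple T) (j : k.-tuple 'I_m) : k.-tuple T :=
  map_tuple (tnth x) j.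

Definition subsample_stat m (m_gt0 : (0 < m)%N) k (k_gt0 : (0 < k)%N)
    (x : m.-tuple T) (j : k.-tuple 'I_m) : R :=
  root_stat k_gt0 (subsample x j) (estimator m_gt0 x).

End subsampling.

Section confidence_interval.
Context (R : realType) (p B : nat).

(* W_(j) for 1 <= j <= B, with the conventions W_(0) = w0 and W_(j) = wtop for
   j > B. *)
Definition order_stat (w0 wtop : \bar R) (w : B.-tuple R) (j : nat) : \bar R :=
  nth wtop (w0 :: [seq v%:E | v <- sort <=%R w]) j.

(* The integers under the absolute values are nonnegative for 0 < alpha < 1. *)
Definition ci_lower_index (alpha : R) : nat :=
  `|Num.floor (B.+1%:R * (alpha / 2))|%N.

Definition ci_width (alpha : R) : nat :=
  `|Num.ceil (B.+1%:R * (1 - alpha))|%N.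

(* W_(0) is min WW: the infimum of WW in the extended reals is this minimum
   whenever it exists. If alpha < 1 / (B + 1), the upper index is B + 1; the
   corresponding wtop is a parameter. *)
Definition subsampling_ci (alpha : R) (WW : set R) (wtop : \bar R)
    (w : B.-tuple R) (Sm : 'rV[R]_p -> R) : set 'rV[R]_p :=
  let i := ci_lower_index alpha in
  let W := order_stat (ereal_inf [set v%:E | v in WW]) wtop w in
  [set theta | (W i <= (Sm theta)%:E < W (ci_width alpha + i)%N)%E].

End confidence_interval.

(* Main.v *)
Require Import Defs.
From mathcomp Require Import measurable_realfun ring lra zify.
From mathcomp Require polyrcf.

(* Let s = S_m(theta_0), which is a function of D, let N be the number of b with
   W_b <= s, and put i = floor((B+1) alpha/2), c = ceil((B+1)(1 - alpha)).
   Conditionally on D, N is binomial with parameters B and F_0(D), so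
   P(i <= N < i + c) = E[G(F_0(D))], where G is a sum of c consecutive binomial
   probabilities. G takes values in [0,1], integrates to c/(B+1) over [0,1] and
   is quasi-concave; its superlevel sets are intervals, hence
   |E[G(F_0(D))] - E[G(U)]| is at most the interval distance between F_0(D) and U.
   The conventions for W_(0) and W_(B+1) can make the coverage event differ from
   {i <= N < i + c} only where F_0(D) is 0 or 1. The coverage therefore lies
   between E[G(F_0(D)); 0 < F_0(D) < 1] and E[G(F_0(D))], and the bound applies
   to both G on ]0,1[ and G on [0,1]. *)

Set Implicit Arguments.
Unset Strict Implicit.
Unset Printing Implicit Defensive.

(** * Sums of consecutive binomial probabilities *)

Section binomial_window.
Context (R : realType).
Implicit Types (n i j k : nat) (x y z : R).

(** Since [XMonemX a b x] is x^a (1 - x)^b, this is the probability that a binomial variable with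
    parameters [n] and [x] lies in {i, ..., k - 1}. *)
Definition binomial_window n i k x : R :=
  \sum_(i <= j < k) 'C(n, j)%:R * XMonemX j (n - j) x.

Lemma measurable_binomial_window n i k : measurable_fun setT (binomial_window n i k).
Proof.
rewrite /binomial_window; apply: measurable_sum => j.
by apply: measurable_funM => //; exact: measurable_XMonemX.
Qed.

Lemma binomial_window_ge0 n i k x : x \in `[0, 1] -> 0 <= binomial_window n i k x.
Proof.
by move=> x01; apply: sumr_ge0 => j _; rewrite mulr_ge0// XMonemX_ge0.
Qed.

Lemma binomial_window_full n x : binomial_window n 0 n.+1 x = 1.
Proof.
rewrite /binomial_window big_mkord; apply: esym; rewrite -[LHS](expr1n _ n).
rewrite -[X in X ^+ n](subrK x 1).
rewrite exprDn; apply: eq_bigr => j _.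
by rewrite mulr_natl mulrC.
Qed.

Lemma binomial_window_le1 n i k x : (i <= k <= n.+1)%N -> x \in `[0, 1] ->
  binomial_window n i k x <= 1.
Proof.
move=> /andP[ik kn] x01; rewrite -(binomial_window_full n x) /binomial_window.
rewrite (@big_cat_nat _ _ _ k 0 n.+1)//= (@big_cat_nat _ _ _ i 0 k)//=.
rewrite -addrA addrCA lerDl addr_ge0//;
  by apply: sumr_ge0 => j _; rewrite mulr_ge0// XMonemX_ge0.
Qed.

(** Every binomial probability has the same integral 1/(n + 1): x^j (1 - x)^(n - j) integrates to
    the beta value j! (n - j)! / (n + 1)!, and the binomial coefficient cancels the factorials of j
    and n - j. *)
Lemma integral_binomial_window n i k : (i <= k <= n.+1)%N ->
  \int[lebesgue_measure]_(x in `[0, 1]) binomial_window n i k x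
    = (k - i)%:R / n.+1%:R.
Proof.
move=> /andP[ik kn].
have iM j : lebesgue_measure.-integrable `[0, 1]
    (EFin \o (fun x : R => 'C(n, j)%:R * XMonemX j (n - j) x)).
  have /integrableZl : lebesgue_measure.-integrable `[0, 1]
    (EFin \o @XMonemX R j (n - j)) by exact: integrable_XMonemX.
  by apply; exact: measurable_itv.
rewrite /Rintegral /binomial_window.
under eq_integral do rewrite -sumEFin.
rewrite integral_sum//.
rewrite (eq_big_nat _ _ (F2 := fun=> (n.+1%:R^-1)%:E)); last first.
  move=> j /andP[ij jk].
  have jn : (j <= n)%N by rewrite -ltnS (leq_trans jk).
  under eq_integral do rewrite EFinM.
  rewrite integralZl//=; last exact: integrable_XMonemX.
  have := @EFin_beta_fun R j.+1 (n - j).+1.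
  rewrite integral_XMonemX_restrict setTI /= => <-.
  rewrite beta_fun_fact -EFinM subnKC//; congr EFin.
  apply: (@mulIf _ n.+1`!%:R); first by rewrite pnatr_eq0 -lt0n fact_gt0.
  rewrite mulrA mulfVK ?pnatr_eq0 -?lt0n ?fact_gt0// -natrM bin_fact//.
  by rewrite factS natrM mulKf// pnatr_eq0.
by rewrite sumEFin sumr_const_nat /= mulr_natl.
Qed.

(* The sum of the derivatives of the binomial probabilities telescopes. *)
Lemma deriv_binomial_window n i k : (i <= k)%N ->
  let t j := (j * 'C(n, j))%:R *: ('X ^+ j.-1 * (1 - 'X) ^+ (n - j)) : {poly R} in
  (\sum_(i <= j < k) 'C(n, j)%:R *: ('X ^+ j * (1 - 'X) ^+ (n - j)))^`() =
    t i - t k.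
Proof.
move=> ik t; rewrite raddf_sum /= -[RHS]opprB -telescope_sumr// -sumrN.
apply: eq_bigr => j _; rewrite opprB /t mul_bin_left !derivCE.
rewrite subnS sub0r mulN1r mulNrn mulrN mulrnAl mulrnAr scalerBr.
by congr (_ - _); rewrite -scalerMnr scalerMnl -mulrnA mulnC.
Qed.

(** If the value at [z] were below both others, the mean value theorem would give a < b with p'(a) <
    0 < p'(b). But in the main case 0 < i, k <= n, the derivative p'(u) is, up to a positive factor,
    A (1 - u)^e - A' u^e with A, A' >= 0, which is nonincreasing in u. *)
Lemma binomial_window_quasiconcave n i k x y z :
  (i < k)%N -> x \in `[0, 1] -> y \in `[0, 1] -> x <= z <= y ->
  Num.min (binomial_window n i k x) (binomial_window n i k y)
    <= binomial_window n i k z.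
Proof.
move=> ik; rewrite !in_itv/= => /andP[x0 _] /andP[_ y1] /andP[].
rewrite le_eqVlt => /predU1P[<-|xz]; first by rewrite ge_min lexx.
rewrite le_eqVlt => /predU1P[->|zy]; first by rewrite ge_min lexx orbT.
rewrite leNgt lt_min; apply/negP => /andP[Gzx Gzy].
pose p : {poly R} :=
  \sum_(i <= j < k) 'C(n, j)%:R *: ('X ^+ j * (1 - 'X) ^+ (n - j)).
have pE u : binomial_window n i k u = p.[u].
  rewrite /binomial_window /p horner_sum.
  by apply: eq_bigr => j _; rewrite !hornerE.
rewrite !pE in Gzx Gzy.
have [a /[!in_itv]/= /andP[xa az] pa] := polyrcf.poly_mvt p xz.
have [b /[!in_itv]/= /andP[zb yb] pb] := polyrcf.poly_mvt p zy.
have pa0 : p^`().[a] < 0.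
  by rewrite -(@pmulr_llt0 _ (z - x)) ?subr_gt0// -pa subr_lt0.
have pb0 : 0 < p^`().[b].
  by rewrite -(@pmulr_lgt0 _ (y - z)) ?subr_gt0// -pb subr_gt0.
have a0 : 0 < a by exact: le_lt_trans xa.
have ab : a < b by exact: lt_trans zb.
have b1 : b < 1 by exact: lt_le_trans y1.
move: pa0 pb0; rewrite /p deriv_binomial_window; last exact: ltnW.
rewrite !hornerE /= subr_lt0 subr_gt0.
have nonneg u j l : 0 < u < 1 ->
    0 <= (j * 'C(n, j))%:R * u ^+ j.-1 * (1 - u) ^+ l :> R.
  by move=> /andP[u0 u1]; rewrite !mulr_ge0 ?exprn_ge0 ?subr_ge0// ltW.
have a1 : a < 1 by exact: lt_trans b1.
have b0 : 0 < b by exact: lt_trans ab.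
(* Boundary cases first. For i = 0 the first term of the derivative vanishes, so the derivative
   cannot be positive at [b]; for k > n the second term vanishes, so it cannot be negative at
   [a]. *)
case: i ik {p pE pa pb Gzx Gzy} => [|i] ik.
  rewrite mul0n !mul0r => _; apply/negP; rewrite -leNgt.
  by apply: nonneg; rewrite b0.
case: k ik => // k ik; have [nk|kn] := ltnP n k.+1.
  rewrite (bin_small nk) muln0 !mul0r => /lt_geF.
  by rewrite nonneg ?a0.
set A := (i.+1 * _)%:R; set A' := (k.+1 * _)%:R => /=.
pose e := (k - i)%N.
have ke : k = (i + e)%N by rewrite subnKC// ltnW.
have ne : (n - i.+1 = (n - k.+1) + e)%N by rewrite ke in kn *; lia.
(* With both indices shifted by one, the two terms share the positive factor u^i (1 - u)^(n - k -
   1); what remains is monotone in u. *)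
have cancel u : 0 < u < 1 -> exists2 v, 0 < v &
    A * u ^+ i * (1 - u) ^+ (n - i.+1) = (A * (1 - u) ^+ e) * v /\
    A' * u ^+ k * (1 - u) ^+ (n - k.+1) = (A' * u ^+ e) * v.
  move=> /andP[u0 u1]; exists (u ^+ i * (1 - u) ^+ (n - k.+1)).
    by rewrite mulr_gt0// exprn_gt0// subr_gt0.
  have -> : u ^+ k = u ^+ i * u ^+ e by rewrite -exprD -ke.
  by rewrite ne exprD; split; ring.
have [|v v0 [-> ->]] := cancel a; first by rewrite a0.
rewrite ltr_pM2r// => Ha.
have [|w w0 [-> ->]] := cancel b; first by rewrite b0.
rewrite ltr_pM2r// => Hb.
have : A' * a ^+ e < A * (1 - b) ^+ e.
  by apply: le_lt_trans Hb; rewrite ler_wpM2l// lerXn2r ?nnegrE// ltW.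
move=> /(lt_trans Ha); rewrite ltNge ler_wpM2l//.
by rewrite lerXn2r ?nnegrE ?subr_ge0 ?lerB// ltW.
Qed.

End binomial_window.

(** * Interval distance and quasi-concave functions *)

Section bounded_integrals.
Context d (T : measurableType d) (R : realType) (Pr : probability T R).
Implicit Types (A C : set T) (f g : T -> R).

Lemma integrable_le1 A f : measurable A -> measurable_fun setT f ->
  (forall x, `|f x| <= 1) -> Pr.-integrable A (EFin \o f).
Proof.
move=> mA mf f1; apply: measurable_bounded_integrable => //.
- by rewrite (le_lt_trans (probability_le1 _ mA))// ltry.
- exact: measurable_funTS.
- by exists 1; split => // r r1 x _ /=; rewrite (le_trans (f1 x))// ltW.
Qed.

Lemma Rintegral_indic A C : measurable A -> measurable C ->
  \int[Pr]_(x in C) (\1_A x : R) = fine (Pr (A `&` C)).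
Proof. by move=> mA mC; rewrite /Rintegral integral_indic. Qed.

Lemma Rintegral_sum (I : Type) (s : seq I) (P : pred I) A (f : I -> T -> R) :
  measurable A -> (forall i, Pr.-integrable A (EFin \o f i)) ->
  \int[Pr]_(x in A) (\sum_(i <- s | P i) f i x) =
    \sum_(i <- s | P i) \int[Pr]_(x in A) f i x.
Proof.
move=> mA fi; rewrite /Rintegral.
under eq_integral do rewrite -sumEFin.
rewrite integral_sum// sum_fine// => i _; exact: integrable_fin_num (fi i).
Qed.

(** Dominated convergence for the indicators, with the constant 1 as dominating function. *)
Lemma cvg_probability (A : (set T)^nat) C :
  (forall n, measurable (A n)) -> measurable C ->
  (forall x, \forall n \near \oo, A n x <-> C x) ->
  fine (Pr (A n)) @[n --> \oo] --> fine (Pr C).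
Proof.
move=> mA mC AC.
have IE B : measurable B -> fine (Pr B) = fine (\int[Pr]_x (\1_B x)%:E)%E.
  by move=> mB; rewrite integral_indic// setIT.
rewrite IE//; under eq_fun do rewrite IE//.
apply: fine_cvg; rewrite fineK; last first.
  by rewrite integral_indic// setIT fin_num_measure.
apply: (@dominated_cvg _ _ _ _ _ measurableT (fun n => EFin \o \1_(A n))
  (EFin \o \1_C) (cst 1%E)) => //.
- by move=> n; apply/measurable_EFinP; exact: measurable_indic.
- move=> x _; apply: cvg_near_cst; near=> n.
  have e : A n x <-> C x by near: n; exact: AC.
  rewrite /= !indicE; congr ((nat_of_bool _)%:R%:E).
  by apply/idP/idP => /set_mem /e /mem_set.
- exact: finite_measure_integrable_cst.
- by move=> n x _ /=; rewrite indicE normr_nat lee_fin; case: (_ \in _).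
Unshelve. all: by end_near. Qed.

End bounded_integrals.

Section interval_discrepancy.
Context (R : realType).

Lemma dKS_ge_abs d1 (O1 : measurableType d1) (P1 : probability O1 R)
    (Y1 : O1 -> R) d2 (O2 : measurableType d2) (P2 : probability O2 R)
    (Y2 : O2 -> R) (s t : R) :
  measurable_fun setT Y1 -> measurable_fun setT Y2 ->
  `|fine (P1 (Y1 @^-1` [set` `]s, t]])) - fine (P2 (Y2 @^-1` [set` `]s, t]]))|
    <= dKS P1 Y1 P2 Y2.
Proof.
(* [sup] is known to dominate the elements only when the set is bounded above; the bound is 1, as
   both probabilities lie in [0, 1]. *)
move=> mY1 mY2; apply: ub_le_sup; last by exists s, t.
have le01 d (O : measurableType d) (P : probability O R) (A : set O) :
    measurable A -> 0 <= fine (P A) <= 1.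
  move=> mA; rewrite fine_ge0//= -lee_fin fineK ?fin_num_measure//.
  exact: probability_le1.
exists 1 => _ [u [v ->]].
have mp d (O : measurableType d) (Y : O -> R) : measurable_fun setT Y ->
    measurable (Y @^-1` [set` `]u, v]]).
  by move=> mY; rewrite -[_ @^-1` _]setTI; exact: mY.
have /andP[? ?] := le01 _ _ P1 _ (mp _ _ _ mY1).
have /andP[? ?] := le01 _ _ P2 _ (mp _ _ _ mY2).
by rewrite ler_norml; apply/andP; split; lra.
Qed.

(** Replaces an arbitrary endpoint by real ones that decide each point correctly in the long run:
    [BLeft a] by a - 1/(n + 1), [BRight a] by a itself, the infinite ones by -n and n. Negating both
    sides gives the version for right endpoints. *)
Lemma itv_bound_approx (b : itv_bound R) :
  exists u : R^nat, forall x, \forall n \near \oo, (u n < x) = (b <= BLeft x)%O.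
Proof.
case: b => [[] a|[]].
- exists (fun n => a - n.+1%:R^-1) => x; rewrite bnd_simp.
  have [ax|xa] := leP a x.
    by apply: nearW => n; rewrite ltrBlDr ltr_pwDr// invr_gt0.
  have ax0 : 0 < a - x by rewrite subr_gt0.
  near=> n; apply/negbTE; rewrite -leNgt lerBrDl -lerBrDr ltW//.
  near: n; exact: (near_infty_natSinv_lt (PosNum ax0)).
- by exists (fun=> a) => x; apply: nearW => n; rewrite bnd_simp.
- exists (fun n => - n%:R) => x; near=> n.
  rewrite bnd_simp ltrNl; near: n; exact: nbhs_infty_gtr.
- exists (fun n => n%:R) => x; near=> n.
  rewrite bnd_simp; apply/negbTE; rewrite -leNgt; near: n.
  exact: nbhs_infty_ger.
Unshelve. all: by end_near. Qed.

(** [dKS] only tests sets []s, t]]; this approximation extends its control to open, closed and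
    unbounded intervals. *)
Lemma is_interval_approx (I : set R) : is_interval I ->
  exists s t : R^nat, forall x,
    \forall n \near \oo, [set` `]s n, t n]] x <-> I x.
Proof.
move=> /is_intervalP ->; case: (Rhull I) => l r.
have [s sl] := itv_bound_approx l; have [t tr] := itv_bound_approx r.
exists s, t => x; near=> n.
have snx : (s n < x) = (l <= BLeft x)%O by near: n; exact: sl.
have tnx : (t n < x) = (r <= BLeft x)%O by near: n; exact: tr.
rewrite /= in_itv/= snx [x <= t n]leNgt tnx itv_boundlr.
suff -> : (BRight x <= r)%O = ~~ (r <= BLeft x)%O by [].
by clear; case: r => [[] a|[]]; rewrite !bnd_simp -?leNgt -?ltNge.
Unshelve. all: by end_near. Qed.

Lemma interval_dKS d1 (O1 : measurableType d1) (P1 : probability O1 R)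
    (Y1 : O1 -> R) d2 (O2 : measurableType d2) (P2 : probability O2 R)
    (Y2 : O2 -> R) (I : set R) :
  measurable_fun setT Y1 -> measurable_fun setT Y2 -> is_interval I ->
  fine (P1 (Y1 @^-1` I)) <= fine (P2 (Y2 @^-1` I)) + dKS P1 Y1 P2 Y2.
Proof.
move=> mY1 mY2 iI; have [s [t st]] := is_interval_approx iI.
have mp d (O : measurableType d) (Y : O -> R) A : measurable_fun setT Y ->
    measurable A -> measurable (Y @^-1` A).
  by move=> mY mA; rewrite -[_ @^-1` _]setTI; exact: mY.
have mI : measurable I by rewrite (is_intervalP I).1//; exact: measurable_itv.
have cvgI d (O : measurableType d) (P : probability O R) (Y : O -> R) :
    measurable_fun setT Y ->
    fine (P (Y @^-1` [set` `]s n, t n]])) @[n --> \oo] --> fine (P (Y @^-1` I)).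
  move=> mY; apply: cvg_probability => [n||w]; [exact: mp|exact: mp|exact: st].
rewrite -lerBlDl.
have c := cvgB (cvgI _ _ P1 _ mY1) (cvgI _ _ P2 _ mY2).
apply: (closed_cvg (fun r => r <= dKS P1 Y1 P2 Y2) _ _ _ (c _)).
  exact: closed_le.
apply: nearW => n; apply: le_trans (dKS_ge_abs _ _ _ _ mY1 mY2).
exact: ler_norm.
Qed.

Lemma dKSC d1 (O1 : measurableType d1) (P1 : probability O1 R)
    (Y1 : O1 -> R) d2 (O2 : measurableType d2) (P2 : probability O2 R)
    (Y2 : O2 -> R) : dKS P1 Y1 P2 Y2 = dKS P2 Y2 P1 Y1.
Proof.
rewrite /dKS; congr sup; apply/seteqP; split => _ [s [t ->]];
  by exists s, t; rewrite distrC.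
Qed.

(** The sum counts the integers in {1, ..., M} not exceeding [y], so it is the integer part of
    [y]. *)
Lemma level_count (M : nat) (y : R) : 0 <= y <= M%:R ->
  \sum_(l < M) (l.+1%:R <= y)%R%:R <= y <= \sum_(l < M) (l.+1%:R <= y)%R%:R + 1.
Proof.
move=> /andP[y0 yM]; have /andP[ty yt] := truncn_itv y0.
set t := Num.truncn y in ty yt.
have tM : (t <= M)%N by rewrite -(ler_nat R) (le_trans ty).
suff -> : \sum_(l < M) (l.+1%:R <= y)%R%:R = t%:R :> R.
  by rewrite ty natr1 ltW.
rewrite -natr_sum; congr (_%:R).
rewrite (eq_bigr (fun l : 'I_M => nat_of_bool (l < t)%N)) => [|l _].
  rewrite -big_mkcond /=.
  by rewrite (big_ord_narrow tM) sum1_card card_ord.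
congr nat_of_bool; apply/idP/idP => [ly|lt].
  by rewrite -ltnS -(ltr_nat R) (le_lt_trans ly).
by rewrite (le_trans _ ty)// ler_nat.
Qed.

(* Up to 1/M, g is the average of the indicators of the intervals
   {g >= l/M} for 1 <= l <= M. *)
Lemma quasiconcave_dKS_le d1 (O1 : measurableType d1) (P1 : probability O1 R)
    (Y1 : O1 -> R) d2 (O2 : measurableType d2) (P2 : probability O2 R)
    (Y2 : O2 -> R) (g : R -> R) :
  measurable_fun setT Y1 -> measurable_fun setT Y2 -> measurable_fun setT g ->
  (forall x, 0 <= g x <= 1) ->
  (forall x y z, x <= z <= y -> Num.min (g x) (g y) <= g z) ->
  \int[P1]_w g (Y1 w) <= \int[P2]_w g (Y2 w) + dKS P1 Y1 P2 Y2.
Proof.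
move=> mY1 mY2 mg g01 gqc; apply/ler_addgt0Pr => e e0.
(* [M] satisfies 1/(M + 1) < e: rounding (M + 1) g to an integer costs at most 1, hence less than e
   after division by M + 1. *)
have [M _ Me] := near_infty_natSinv_lt (PosNum e0).
pose I (l : nat) : set R := [set x | l.+1%:R <= M.+1%:R * g x].
(* Quasi-concavity enters here: superlevel sets are intervals, so [interval_dKS] applies to each of
   the M + 1 levels. *)
have iI l : is_interval (I l).
  move=> x y Ix Iy z xzy; rewrite /I/= (le_trans _ (ler_wpM2l _ (gqc _ _ _ xzy)))//.
  by rewrite minr_pMr// le_min Ix.
have mI l : measurable (I l) by rewrite (is_intervalP (I l)).1//; exact: measurable_itv.
pose S x : R := \sum_(l < M.+1) \1_(I l) x.
have SE x : S x = \sum_(l < M.+1) (l.+1%:R <= M.+1%:R * g x)%R%:R.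
  apply: eq_bigr => l _; rewrite indicE; congr ((nat_of_bool _)%:R).
  by apply/idP/idP => [/set_mem|/mem_set].
have Sg x : S x <= M.+1%:R * g x <= S x + 1.
  rewrite SE; apply: level_count; have /andP[g0 g1] := g01 x.
  by rewrite mulr_ge0//= ler_piMr.
have mp d (O : measurableType d) (Y : O -> R) l : measurable_fun setT Y ->
    measurable (Y @^-1` I l).
  by move=> mY; rewrite -[_ @^-1` _]setTI; exact: mY.
have igY d (O : measurableType d) (P : probability O R) (Y : O -> R) :
    measurable_fun setT Y -> P.-integrable setT (EFin \o (g \o Y)).
  move=> mY; apply: integrable_le1 => //; first exact: measurableT_comp.
  by move=> w; rewrite ger0_norm; case/andP: (g01 (Y w)).
have iIY d (O : measurableType d) (P : probability O R) (Y : O -> R) l :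
    measurable_fun setT Y -> P.-integrable setT (EFin \o (\1_(I l) \o Y)).
  move=> mY; apply: integrable_le1 => //.
    by apply: measurableT_comp => //; exact: measurable_indic.
  by move=> w /=; rewrite indicE normr_nat lern1; case: (_ \in _).
have intS d (O : measurableType d) (P : probability O R) (Y : O -> R) :
    measurable_fun setT Y ->
    \int[P]_w S (Y w) = \sum_(l < M.+1) fine (P (Y @^-1` I l)).
  move=> mY; rewrite Rintegral_sum//; last by move=> l; exact: iIY.
  apply: eq_bigr => l _; rewrite -[in RHS](setIT (_ @^-1` _)) -Rintegral_indic//.
  exact: mp.
have iS d (O : measurableType d) (P : probability O R) (Y : O -> R) :
    measurable_fun setT Y -> P.-integrable setT (EFin \o (S \o Y)).
  move=> mY; rewrite (_ : _ \o _ = fun w => (\sum_(l < M.+1) (\1_(I l) (Y w))%:E)%E).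
    by apply: integrable_sum => // l _; exact: iIY.
  by apply/funext => w /=; rewrite /S sumEFin.
have iMg d (O : measurableType d) (P : probability O R) (Y : O -> R) :
    measurable_fun setT Y ->
    P.-integrable setT (EFin \o (fun w => M.+1%:R * g (Y w))).
  by move=> mY; exact: (integrableZl measurableT _ (igY _ _ P _ mY)).
have up : M.+1%:R * \int[P1]_w g (Y1 w) <= \int[P1]_w S (Y1 w) + 1.
  rewrite -RintegralZl//; last exact: igY.
  have i1 : P1.-integrable setT (EFin \o cst 1).
    exact: finite_measure_integrable_cst.
  have c1 : \int[P1]_w (cst 1 w) = 1.
    by rewrite (Rintegral_cst P1 measurableT) mul1r /= probability_setT.
  rewrite -[X in _ + X]c1 -(RintegralD measurableT (iS _ _ P1 _ mY1) i1).
  apply: le_Rintegral => //; first exact: (iMg _ _ P1 _ mY1).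
    exact: (integrableD measurableT (iS _ _ P1 _ mY1) i1).
  by move=> w _; case/andP: (Sg (Y1 w)).
have lo : \int[P2]_w S (Y2 w) <= M.+1%:R * \int[P2]_w g (Y2 w).
  rewrite -RintegralZl//; last exact: igY.
  apply: le_Rintegral => //; [exact: (iS _ _ P2 _ mY2)|exact: (iMg _ _ P2 _ mY2)|].
  by move=> w _; case/andP: (Sg (Y2 w)).
have mid : \int[P1]_w S (Y1 w) <=
    \int[P2]_w S (Y2 w) + M.+1%:R * dKS P1 Y1 P2 Y2.
  rewrite !intS// mulr_natl -[X in _ *+ X]card_ord -sumr_const -big_split /=.
  by apply: ler_sum => l _; exact: interval_dKS.
have M0 : 0 < M.+1%:R :> R by rewrite ltr0n.
rewrite -(ler_pM2l M0) !mulrDr.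
apply: (le_trans up); apply: lerD; first by rewrite (le_trans mid)// lerD2r.
have {}Me := Me M (leqnn _); rewrite /= in Me.
by rewrite -ler_pdivrMl// mulr1 ltW.
Qed.

Lemma quasiconcave_dKS d1 (O1 : measurableType d1) (P1 : probability O1 R)
    (Y1 : O1 -> R) d2 (O2 : measurableType d2) (P2 : probability O2 R)
    (Y2 : O2 -> R) (g : R -> R) :
  measurable_fun setT Y1 -> measurable_fun setT Y2 -> measurable_fun setT g ->
  (forall x, 0 <= g x <= 1) ->
  (forall x y z, x <= z <= y -> Num.min (g x) (g y) <= g z) ->
  `|\int[P1]_w g (Y1 w) - \int[P2]_w g (Y2 w)| <= dKS P1 Y1 P2 Y2.
Proof.
move=> mY1 mY2 mg g01 gqc; rewrite ler_distlC -lerBlDr.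
have := quasiconcave_dKS_le P1 P2 mY1 mY2 mg g01 gqc.
have := quasiconcave_dKS_le P2 P1 mY2 mY1 mg g01 gqc.
by rewrite dKSC => ? ?; apply/andP; split; lra.
Qed.

End interval_discrepancy.

(** * Conditional probabilities and random thresholds *)

Section conditional_probability.
Context dO (O : measurableType dO) (R : realType) (Pr : probability O R).
Context dS (S : measurableType dS) (D : O -> S) (mD : measurable_fun setT D).
Implicit Types (A H : set O) (C : set S) (f : S -> R).

Lemma measurable_preimage_D C : measurable C -> measurable (D @^-1` C).
Proof. by move=> mC; rewrite -[_ @^-1` _]setTI; exact: mD. Qed.
Let mDC := measurable_preimage_D.

Lemma integrable_comp_D C f : measurable C -> measurable_fun setT f ->
  (forall x, 0 <= f x <= 1) -> Pr.-integrable (D @^-1` C) (EFin \o (f \o D)).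
Proof.
move=> mC mf f01; apply: integrable_le1 => //; first exact: mDC.
  exact: measurableT_comp.
by move=> w; rewrite ger0_norm; case/andP: (f01 (D w)).
Qed.

(** The integral of |g| over [A] must be zero, so g vanishes almost everywhere on [A]; positivity
    then leaves only a null set. *)
Lemma gt0_integral_eq0 A (g : O -> R) : measurable A -> measurable_fun A g ->
  (forall w, A w -> 0 < g w) -> (\int[Pr]_(w in A) (g w)%:E <= 0)%E -> Pr A = 0%E.
Proof.
move=> mA mg g0 ig.
have : (\int[Pr]_(w in A) `|(EFin \o g) w| = 0)%E.
  apply/eqP; rewrite eq_le integral_ge0// andbT (le_trans _ ig)//.
  rewrite le_eqVlt; apply/orP; left; apply/eqP/eq_integral => w /set_mem Aw.
  by rewrite gee0_abs// lee_fin ltW// g0.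
move/(ae_eq_integral_abs Pr mA) => []; first exact/measurable_EFinP.
move=> N [mN N0 sN]; apply/eqP; rewrite eq_le measure_ge0 andbT -N0 le_measure ?inE//.
move=> w Aw; apply: sN => /(_ Aw) [] gw0.
by have := g0 _ Aw; rewrite gw0 ltxx.
Qed.

(** A version of a conditional probability may leave [0, 1] on a null set; clipping gives a version
    with values in [0, 1] everywhere. *)
Definition clip01 (r : R) : R := Num.max 0 (Num.min r 1).

Lemma clip01_itv r : 0 <= clip01 r <= 1.
Proof. by rewrite /clip01 le_max lexx ge_max ler01 ge_min lexx orbT. Qed.

Lemma clip01_id r : 0 <= r <= 1 -> clip01 r = r.
Proof. by move=> /andP[r0 r1]; rewrite /clip01 min_l// max_r. Qed.

Lemma measurable_clip01 f : measurable_fun setT f ->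
  measurable_fun setT (clip01 \o f).
Proof. by move=> mf; apply: measurable_maxr => //; exact: measurable_minr. Qed.

(** Over {f(D) < 0} the integral of f(D) is a probability, hence nonnegative; over {f(D) > 1} it is
    at most the probability of that event. Both events are therefore null. *)
Lemma is_cond_prob_ae01 A f : measurable A -> is_cond_prob Pr D A f ->
  exists2 N, measurable N /\ Pr N = 0%E & forall w, ~ N w -> 0 <= f (D w) <= 1.
Proof.
move=> mA [mf fA].
pose C0 := f @^-1` `]-oo, 0[; pose C1 := f @^-1` `]1, +oo[.
have mC0 : measurable C0 by rewrite /C0 -[_ @^-1` _]setTI; exact: mf.
have mC1 : measurable C1 by rewrite /C1 -[_ @^-1` _]setTI; exact: mf.
have mfD E : measurable_fun E (f \o D).
  by apply: measurable_funTS; exact: measurableT_comp.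
have P0 : Pr (D @^-1` C0) = 0%E.
  apply: (@gt0_integral_eq0 _ (\- (f \o D))) => //; first exact: mDC.
  - exact: measurableT_comp.
  - by move=> w; rewrite /C0/= in_itv/= oppr_gt0.
  - have e : (\int[Pr]_(w in D @^-1` C0) (f (D w))%:E =
       - \int[Pr]_(w in D @^-1` C0) (- f (D w))%:E)%E.
      rewrite -integral_ge0N => [|w].
        by apply: eq_integral => w _; rewrite EFinN oppeK.
      by rewrite /C0/= in_itv/= => /ltW; rewrite lee_fin oppr_ge0.
    by rewrite /= -[leLHS]oppeK -e fA// oppe_le0 measure_ge0.
have P1 : Pr (D @^-1` C1) = 0%E.
  apply: (@gt0_integral_eq0 _ (fun w => f (D w) - 1)) => //; first exact: mDC.
  - exact: measurable_funB.
  - by move=> w; rewrite /C1/= in_itv/= andbT subr_gt0.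
  - have mC1' := mDC mC1.
    have : (\int[Pr]_(w in D @^-1` C1) (f (D w) - 1)%:E + Pr (D @^-1` C1)
       <= Pr (D @^-1` C1))%E.
      rewrite -{1}(mul1e (Pr _)) -integral_cst// -ge0_integralD//; last 2 first.
      + move=> w; rewrite /C1/= in_itv/= andbT lee_fin subr_ge0; exact: ltW.
      + by apply/measurable_EFinP; exact: measurable_funB.
      under eq_integral do rewrite -EFinD subrK.
      by rewrite fA// le_measure// inE//; exact: measurableI.
    by rewrite -leeBrDr ?fin_num_measure// subee// fin_num_measure.
exists (D @^-1` C0 `|` D @^-1` C1).
  split; first by apply: measurableU; exact: mDC.
  by apply: null_set_setU => //; exact: mDC.
by move=> w /not_orP []; rewrite /C0/C1/= !in_itv/= andbT => /negP + /negP;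
  rewrite -!leNgt => -> ->.
Qed.

Lemma is_cond_prob_clip A f : measurable A -> is_cond_prob Pr D A f ->
  is_cond_prob Pr D A (clip01 \o f).
Proof.
move=> mA fA; have [N [mN N0] Nf] := is_cond_prob_ae01 mA fA.
have [mf fAE] := fA; split => [|C mC]; first exact: measurable_clip01.
rewrite -fAE//; apply: ae_eq_integral => //; first exact: mDC.
- apply/measurable_EFinP/measurable_funTS/measurableT_comp => //.
  exact: measurable_clip01.
- by apply/measurable_EFinP/measurable_funTS; exact: measurableT_comp.
- exists N; split=> // w /= h; apply: contrapT => /Nf f01; apply: h => _.
  by rewrite clip01_id.
Qed.

Lemma is_cond_probC A f : measurable A -> is_cond_prob Pr D A f ->
  (forall x, 0 <= f x <= 1) -> is_cond_prob Pr D (~` A) (fun x => 1 - f x).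
Proof.
move=> mA [mf fA] f01; split => [|C mC]; first exact: measurable_funB.
have mC' := mDC mC.
have if' := integrable_comp_D mC mf f01.
under eq_integral do rewrite EFinB.
rewrite integralB//; last exact: finite_measure_integrable_cst.
rewrite fA// integral_cst// mul1e [in RHS]setIC -setDE measureD//.
  by congr (_ - Pr _)%E; rewrite setIC.
by rewrite (le_lt_trans (probability_le1 _ _))// ltry.
Qed.

Lemma measurable_glue (h : S -> nat) (q : nat -> S -> R) :
  (forall n, measurable (h @^-1` [set n])) ->
  (forall n, measurable_fun setT (q n)) -> measurable_fun setT (fun x => q (h x) x).
Proof.
move=> mh mq _ B mB; rewrite setTI.
rewrite (_ : _ @^-1` _ = \bigcup_n (h @^-1` [set n] `&` q n @^-1` B)).
  apply: bigcup_measurable => n _; apply: measurableI => //.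
  by rewrite -[_ @^-1` _]setTI; exact: mq.
by apply/seteqP; split => [x Bx|x [n _ [/= <-]]//]; exists (h x).
Qed.

(** Splitting along the countably many values of h(D) reduces the identity to a fixed index [n],
    where [q n] applies; countable additivity reassembles the pieces. *)
Lemma is_cond_prob_glue (h : S -> nat) (A : nat -> set O) (q : nat -> S -> R) :
  (forall n, measurable (h @^-1` [set n])) -> (forall n, measurable (A n)) ->
  (forall n x, 0 <= q n x) -> (forall n, is_cond_prob Pr D (A n) (q n)) ->
  is_cond_prob Pr D [set w | A (h (D w)) w] (fun x => q (h x) x).
Proof.
move=> mh mA q0 qA.
have mq : measurable_fun setT (fun x => q (h x) x).
  by apply: measurable_glue => // n; exact: (qA n).1.
split=> // C mC.
pose F n := D @^-1` (C `&` h @^-1` [set n]).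
have mF n : measurable (F n) by apply: mDC; exact: measurableI.
have DF : D @^-1` C = \bigcup_n F n.
  by apply/seteqP; split => [w Cw|w [n _ []]//]; exists (h (D w)).
have tF : trivIset setT F.
  by move=> i j _ _ [w [[_ /= <-] [_ /= <-]]].
rewrite DF ge0_integral_bigcup//; last 2 first.
- apply/measurable_EFinP/measurable_funTS.
  by apply: (measurableT_comp (f := fun x => q (h x) x)).
- by move=> w _; rewrite lee_fin.
rewrite setI_bigcupr.
rewrite (eq_bigcupr (G := fun n => A n `&` F n)); last first.
  by move=> n _; apply/seteqP; split => w [/= + [Cw /= e]]; rewrite e.
rewrite measure_bigcup//=; last 2 first.
- by move=> n _; exact: measurableI.
- by apply: trivIset_setIl.
rewrite [RHS](@eq_eseriesl _ _ xpredT); last by move=> n; rewrite in_setT.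
apply: eq_eseriesr => n _; rewrite -(qA n).2; last exact: measurableI.
by apply: eq_integral => w /set_mem [_ /= ->].
Qed.

Lemma fine_cond_prob A f C : is_cond_prob Pr D A f -> measurable C ->
  \int[Pr]_(w in D @^-1` C) f (D w) = fine (Pr (A `&` D @^-1` C)).
Proof. by move=> [_ fA] mC; rewrite /Rintegral fA. Qed.

Lemma probability_agree A A' H C : measurable A -> measurable A' -> measurable H ->
  measurable C ->
  (forall w, ~ H w -> A w <-> A' w) ->
  fine (Pr (A `&` D @^-1` C)) <=
    fine (Pr (A' `&` D @^-1` C)) + fine (Pr (H `&` D @^-1` C)).
Proof.
move=> mA mA' mH mC AA'; have mC' := mDC mC.
have [m m' mh] : [/\ measurable (A `&` D @^-1` C),
  measurable (A' `&` D @^-1` C) & measurable (H `&` D @^-1` C)].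
  by split; exact: measurableI.
rewrite -fineD ?fin_num_measure// fine_le ?fin_num_measure//.
  by rewrite fin_numD !fin_num_measure.
apply: (@le_trans _ _ (Pr ((A' `&` D @^-1` C) `|` (H `&` D @^-1` C)))).
  rewrite le_measure ?inE//; first exact: measurableU.
  move=> w [Aw Cw]; have [Hw|Hw] := pselect (H w); [by right|].
  by left; split => //; apply/AA'.
exact: measureU2.
Qed.

(** On {f <= f'} and on its complement the integrand has a fixed sign, so each integral is a
    difference of probabilities of [A] and [A'] within one event determined by D. It is bounded by
    the part of [H] in that event, and the two parts add up to [H]. *)
Lemma cond_prob_dist A A' f f' H : measurable A -> measurable A' -> measurable H ->
  is_cond_prob Pr D A f -> is_cond_prob Pr D A' f' ->
  (forall x, 0 <= f x <= 1) -> (forall x, 0 <= f' x <= 1) ->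
  (forall w, ~ H w -> A w <-> A' w) ->
  \int[Pr]_w `|f (D w) - f' (D w)| <= fine (Pr H).
Proof.
move=> mA mA' mH fA fA' f01 f01' AA'.
have [mf _] := fA; have [mf' _] := fA'.
pose C := [set x | f x <= f' x].
have mC : measurable C.
  by rewrite -[C]setTI; exact: (measurable_fun_ler mf mf' measurableT).
have mC' : measurable (~` C) by exact: measurableC.
have mCD := mDC mC; have mCD' := mDC mC'.
have i (E : set S) (g : S -> R) : measurable E -> measurable_fun setT g ->
    (forall x, 0 <= g x <= 1) ->
    Pr.-integrable (D @^-1` E) (EFin \o (g \o D)) by exact: integrable_comp_D.
have idiff E : measurable E ->
    Pr.-integrable E (EFin \o (fun w => `|f (D w) - f' (D w)|)).
  move=> mE; apply: integrable_le1 => //.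
    apply: measurableT_comp => //; apply: measurable_funB;
    exact: measurableT_comp.
  move=> w; rewrite normr_id ler_norml.
  have /andP[? ?] := f01 (D w); have /andP[? ?] := f01' (D w).
  by apply/andP; split; lra.
have TE : [set: O] = (D @^-1` C) `|` (D @^-1` (~` C)).
  by rewrite -preimage_setU setUv preimage_setT.
rewrite [X in \int[_]_(_ in X) _]TE Rintegral_setU//; last 2 first.
- by rewrite -TE; exact: idiff.
- by rewrite disj_set2E -preimage_setI setICr preimage_set0.
rewrite (@eq_Rintegral _ _ _ _ _ (fun w => f' (D w) - f (D w))); last first.
  by move=> w /set_mem Cw; rewrite distrC ger0_norm// subr_ge0.
rewrite [X in _ + X](@eq_Rintegral _ _ _ _ _ (fun w => f (D w) - f' (D w))); last first.
  move=> w /set_mem /negP; rewrite -ltNge => Cw.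
  by rewrite gtr0_norm// subr_gt0.
rewrite !RintegralB//; try exact: i.
rewrite !(fine_cond_prob fA)// !(fine_cond_prob fA')//.
have h1 := probability_agree mA' mA mH mC (fun w hw => iff_sym (AA' w hw)).
have h2 := probability_agree mA mA' mH mC' AA'.
have -> : Pr H = (Pr (H `&` D @^-1` C) + Pr (H `&` D @^-1` (~` C)))%E.
  rewrite -measureU//; [|exact: measurableI|exact: measurableI|].
    by rewrite -setIUr -TE setIT.
  by rewrite setIACA preimage_setC setICr setI0.
rewrite fineD ?fin_num_measure//; [lra|exact: measurableI|exact: measurableI].
Qed.

(** * The set of [W b] below a random threshold *)

Section threshold.
Context (B : nat) (W : 'I_B -> O -> R).
Hypotheses (mW : forall b, measurable_fun setT (W b)) (WD : cond_iid Pr D W).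
Implicit Types (I : {set 'I_B}) (s : S -> R).

(** The set of indices is recorded rather than its size, because for a fixed set conditional
    independence yields a product. *)
Definition below s (w : O) : {set 'I_B} := finset (fun b => W b w <= s (D w)).

Lemma below_eq s I w : below s w = I <-> forall b, (W b w <= s (D w)) = (b \in I).
Proof.
split => [<- b|sI]; first by rewrite inE.
by apply/setP => b; rewrite inE.
Qed.

Lemma measurable_below s (b : 'I_B) : measurable_fun setT s ->
  measurable [set w | W b w <= s (D w)].
Proof.
move=> ms; rewrite -[X in measurable X]setTI.
by apply: measurable_fun_ler => //; exact: measurableT_comp.
Qed.

Lemma measurable_below_eq s I : measurable_fun setT s ->
  measurable [set w | below s w = I].
Proof.
move=> ms; rewrite (_ : [set _ | _] = \bigcap_b
    (if b \in I then [set w | W b w <= s (D w)] else ~` [set w | W b w <= s (D w)])).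
  apply: fin_bigcap_measurable => // b _; case: ifP => _.
    exact: measurable_below.
  by apply: measurableC; exact: measurable_below.
apply/seteqP; split => w /=; rewrite below_eq.
  by move=> h b _; have := h b; case: ifP => _ /= ->.
move=> h b; have := h b Logic.I; case: ifP => _ //=.
by move/negP/negbTE.
Qed.

Definition below_prob I (p : R) : R := \prod_(b < B) if b \in I then p else 1 - p.

Lemma below_prob01 I p : 0 <= p <= 1 -> 0 <= below_prob I p <= 1.
Proof.
move=> /andP[p0 p1]; rewrite /below_prob; apply/andP; split.
  by apply: prodr_ge0 => b _; case: ifP; rewrite // subr_ge0.
apply: prodr_ile1 => b _; case: ifP => _; first by rewrite p0.
by rewrite subr_ge0 p1 lerBlDr lerDl.
Qed.

(** The products have [B] factors of absolute value at most 1, and corresponding factors differ by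
    |p - q|; the factors are exchanged one at a time. *)
Lemma below_prob_dist I p q : 0 <= p <= 1 -> 0 <= q <= 1 ->
  `|below_prob I p - below_prob I q| <= B%:R * `|p - q|.
Proof.
move=> p01 q01; pose r (u : R) (b : 'I_B) := if b \in I then u else 1 - u.
have r1 u b : 0 <= u <= 1 -> `|r u b| <= 1.
  by move=> /andP[u0 u1]; rewrite /r ler_norml; case: ifP => _; apply/andP; split; lra.
suff H (l : seq 'I_B) : `|\prod_(b <- l) r p b - \prod_(b <- l) r q b|
    <= (size l)%:R * `|p - q|.
  by have := H (index_enum 'I_B); rewrite -sum1_size sum1_card card_ord.
elim: l => [|b l IHl]; first by rewrite !big_nil subrr normr0 mul0r.
rewrite !big_cons /=; set x := \prod_(_ <- _) _; set y := \prod_(_ <- _) _.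
have y1 : `|y| <= 1.
  rewrite normr_prod; apply: prodr_ile1 => i _.
  by rewrite normr_ge0 r1.
have -> : r p b * x - r q b * y = r p b * (x - y) + (r p b - r q b) * y by ring.
have rpq : `|r p b - r q b| = `|p - q|.
  by rewrite /r; case: ifP => // _; rewrite distrC; congr `|_|; ring.
rewrite (le_trans (ler_normD _ _))// !normrM rpq mulrSr mulrDl mul1r.
apply: lerD; last by rewrite ler_piMr.
by apply: le_trans IHl; rewrite ler_piMl// r1.
Qed.

Lemma measurable_below_prob I s : measurable_fun setT s ->
  measurable_fun setT (fun x => below_prob I (s x)).
Proof.
move=> ms; apply: measurable_prod => b _; case: (b \in I) => //.
exact: measurable_funB.
Qed.

(** For each fixed threshold [t n], [cond_iid] applies to the half-line []-oo, t n]]; the resulting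
    versions are glued along the values of [h]. *)
Lemma cond_iid_glue (h : S -> nat) (t : nat -> R) :
  (forall n, measurable (h @^-1` [set n])) ->
  exists f, [/\ forall x, 0 <= f x <= 1,
    forall b, is_cond_prob Pr D [set w | W b w <= t (h (D w))] f &
    forall I, is_cond_prob Pr D [set w | below (t \o h) w = I]
      (below_prob I \o f)].
Proof.
move=> mh; have [Wid Wind] := WD.
have mWp b (C : set R) : measurable C -> measurable (W b @^-1` C).
  by move=> mC; rewrite -[_ @^-1` _]setTI; exact: mW.
have /choice[q qP] n : exists q, (forall x, 0 <= q x <= 1) /\
    forall b, is_cond_prob Pr D (W b @^-1` `]-oo, t n]) q.
  have [q qP] := Wid `]-oo, t n]%classic (measurable_itv _).
  exists (clip01 \o q); split => [x|b]; first exact: clip01_itv.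
  by apply: is_cond_prob_clip => //; exact: mWp.
have q01 n x := (qP n).1 x; have qW n b := (qP n).2 b.
exists (fun x => q (h x) x); split => [x|b|I]; first exact: q01.
- have := @is_cond_prob_glue h (fun n => W b @^-1` `]-oo, t n]) q mh.
  rewrite (_ : [set w | _] = [set w | W b w <= t (h (D w))]); last first.
    by apply/seteqP; split => w /=; rewrite in_itv.
  apply => // [n|n x]; first exact: mWp.
  by case/andP: (q01 n x).
- pose K n b : set R := if b \in I then `]-oo, t n]%classic else ~` `]-oo, t n].
  have mK n b : measurable (K n b) by rewrite /K; case: ifP => // _; exact: measurableC.
  have := @is_cond_prob_glue h (fun n => \bigcap_b W b @^-1` K n b)
    (fun n x => below_prob I (q n x)) mh.
  rewrite (_ : [set w | _] = [set w | below (t \o h) w = I]); last first.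
    apply/seteqP; split => w /=; rewrite below_eq.
      move=> Kw b; have := Kw b Logic.I; rewrite /K/=.
      by case: ifP => _ /=; rewrite in_itv//= => /negP/negbTE.
    move=> Kw b _; have := Kw b; rewrite /K/=.
    by case: ifP => _ /=; rewrite in_itv//= => ->.
  apply => [n|n x|n].
  + by apply: fin_bigcap_measurable => // b _; exact: mWp.
  + by case/andP: (below_prob01 I (q01 n x)).
  + apply: (Wind (K n) (fun b x => if b \in I then q n x else 1 - q n x)) => // b.
    rewrite /K; case: (b \in I) => //; rewrite preimage_setC.
    by apply: (is_cond_probC _ (qW n b) (q01 n)); exact: mWp.
Qed.

(* The random threshold s(D) is approximated from above by
   s_n = (floor ((n + 1) s) + 1) / (n + 1), which takes countably many values. *)
Lemma cond_iid_below s (b : 'I_B) (f : S -> R) : measurable_fun setT s ->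
  is_cond_prob Pr D [set w | W b w <= s (D w)] f -> (forall x, 0 <= f x <= 1) ->
  forall I, is_cond_prob Pr D [set w | below s w = I] (below_prob I \o f).
Proof.
move=> ms fb f01 I.
have mf : measurable_fun setT f := fb.1.
pose E := [set w | below s w = I].
have mE : measurable E by exact: measurable_below_eq.
split => [|C mC]; first exact: measurable_below_prob.
have mfI : measurable_fun setT (below_prob I \o f) by exact: measurable_below_prob.
have fI01 x := below_prob01 I (f01 x).
have mCD := measurable_preimage_D mC.
have iI : (\int[Pr]_(w in D @^-1` C) ((below_prob I \o f) (D w))%:E)%E \is a fin_num.
  apply: integrable_fin_num => //; exact: (integrable_comp_D mC mfI fI01).
rewrite -(fineK iI) -[RHS]fineK ?fin_num_measure//; last exact: measurableI.
congr EFin; rewrite -/(Rintegral _ _ _).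
(* The approximating threshold lies in ]s, s + 1/(n + 1)], so off [H n] it selects the same indices
   as s. *)
pose H n := [set w | exists b, s (D w) < W b w <= s (D w) + n.+1%:R^-1].
have mH n : measurable (H n).
  rewrite (_ : H n = \bigcup_b [set w | s (D w) < W b w <= s (D w) + n.+1%:R^-1]).
    apply: fin_bigcup_measurable => // b' _.
    rewrite -[X in measurable X]setTI; apply: measurable_and => //.
      by apply: measurable_fun_ltr => //; exact: measurableT_comp.
    apply: measurable_fun_ler => //; apply: measurable_funD => //.
    exact: measurableT_comp.
  by apply/seteqP; split => [w [b' hb]|w [b' _ hb]]; exists b'.
(* At a fixed w, each of the finitely many [W b] above s is eventually above s + 1/(n + 1). *)
have H0 : fine (Pr (H n)) @[n --> \oo] --> (0 : R).
  rewrite -[X in _ --> X]/(fine 0%E) -(measure0 Pr).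
  apply: cvg_probability => // w.
  near=> n; split => //= -[b' /andP[sW Ws]].
  suff : n.+1%:R^-1 < W b' w - s (D w) by rewrite ltrBrDl ltNge Ws.
  move: b' sW {Ws}; near: n; apply: filter_forall => b'.
  have [sW|] := ltP (s (D w)) (W b' w); last by move=> _; exact: nearW.
  have P0 : 0 < W b' w - s (D w) by rewrite subr_gt0.
  by near=> n => _; near: n; exact: (near_infty_natSinv_lt (PosNum P0)).
(* [B] is the Lipschitz constant of [below_prob I], applied to the L1 distance between the
   conditional probabilities for the two thresholds; the extra 1 pays for replacing the event [E] by
   its approximation. *)
suff key n : `|\int[Pr]_(w in D @^-1` C) (below_prob I (f (D w)))
    - fine (Pr (E `&` D @^-1` C))| <= (B%:R + 1) * fine (Pr (H n)).
  apply/eqP; rewrite -subr_eq0 -normr_le0 -(mulr0 (B%:R + 1)).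
  have cH : (B%:R + 1) * fine (Pr (H n)) @[n --> \oo] --> ((B%:R + 1) * 0 : R).
    by apply: cvgM => //; exact: cvg_cst.
  set v := (X in X <= _).
  apply: (closed_cvg (fun r => v <= r) _ _ _ cH); first exact: closed_ge.
  by apply: nearW => n; exact: key.
pose z x := Num.floor (s x * n.+1%:R).
(* Gluing is indexed by [nat], so the integer floor is encoded by [pickle]; the default 0 concerns
   only numbers that encode no integer, and [h] never takes such values. *)
pose t j : R := (odflt 0 (unpickle j) + 1)%:~R / n.+1%:R.
pose h := @pickle int \o z.
have sh x : s x < (t \o h) x <= s x + n.+1%:R^-1.
  rewrite /t /h /= pickleK /= ltr_pdivlMr ?ltr0n// floorD1_gt/=.
  by rewrite intrD mulrDl mul1r lerD2r ler_pdivrMr ?ltr0n// floor_le.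
have mh j : measurable (h @^-1` [set j]).
  have [[v vj]|nj] := pselect (exists v : int, pickle v = j); last first.
    rewrite (_ : _ @^-1` _ = set0)//; apply/seteqP; split => // x /= hx.
    by apply: nj; exists (z x).
  rewrite (_ : _ @^-1` _ = [set x | v%:~R <= s x * n.+1%:R < (v + 1)%:~R]).
    rewrite -[X in measurable X]setTI; apply: measurable_and => //.
      by apply: measurable_fun_ler => //; exact: measurable_funM.
    by apply: measurable_fun_ltr => //; exact: measurable_funM.
  apply/seteqP; split => x /=; rewrite -floor_eq -vj.
    by move=> /(pcan_inj pickleK) <-.
  by move=> /eqP <-.
have [g [g01 gW gI]] := cond_iid_glue t mh.
have mth : measurable_fun setT (t \o h).
  by apply: (measurable_glue (q := fun j => cst (t j))).
have agree b' w : ~ H n w -> (W b' w <= s (D w)) = (W b' w <= (t \o h) (D w)).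
  move=> nH; have /andP[sth ths] := sh (D w).
  apply/idP/idP => [Ws|Wt]; first by rewrite (le_trans Ws)// ltW.
  rewrite leNgt; apply/negP => sW; apply: nH; exists b'.
  by rewrite sW (le_trans Wt).
pose E' := [set w | below (t \o h) w = I].
have EE' w : ~ H n w -> E w <-> E' w.
  move=> nH; rewrite /E /E' /= !below_eq.
  by split => h' b'; rewrite -h' agree.
have mE' : measurable E' by exact: measurable_below_eq.
have dE : `|fine (Pr (E `&` D @^-1` C)) - fine (Pr (E' `&` D @^-1` C))|
    <= fine (Pr (H n)).
  have HC : fine (Pr (H n `&` D @^-1` C)) <= fine (Pr (H n)).
    have mHC : measurable (H n `&` D @^-1` C) by exact: measurableI.
    by rewrite fine_le ?fin_num_measure// le_measure ?inE.
  have := probability_agree mE mE' (mH n) mC EE'.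
  have := probability_agree mE' mE (mH n) mC (fun w nH => iff_sym (EE' w nH)).
  by move=> ? ?; rewrite ler_norml; apply/andP; split; lra.
rewrite -(fine_cond_prob (gI I) mC) in dE.
have mg : measurable_fun setT g := (gW b).1.
have mgI : measurable_fun setT (below_prob I \o g) by exact: measurable_below_prob.
have gI01 x := below_prob01 I (g01 x).
have df : \int[Pr]_w `|f (D w) - g (D w)| <= fine (Pr (H n)).
  apply: (cond_prob_dist (H := H n) _ _ _ fb (gW b)) => //.
  - exact: measurable_below.
  - exact: (measurable_below b mth).
  - by move=> w nH /=; rewrite agree.
have ifg A : measurable A ->
    Pr.-integrable A (EFin \o (fun w => `|f (D w) - g (D w)|)).
  move=> mA; apply: integrable_le1 => //.
    apply: measurableT_comp => //; apply: measurable_funB; exact: measurableT_comp.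
  move=> w; rewrite normr_id ler_norml.
  have /andP[? ?] := f01 (D w); have /andP[? ?] := g01 (D w).
  by apply/andP; split; lra.
have dI : `|\int[Pr]_(w in D @^-1` C) (below_prob I (f (D w))) -
    \int[Pr]_(w in D @^-1` C) (below_prob I (g (D w)))| <= B%:R * fine (Pr (H n)).
  have iF := integrable_comp_D mC mfI fI01.
  have iG := integrable_comp_D mC mgI gI01.
  rewrite -(RintegralB mCD iF iG).
  apply: le_trans (le_normr_Rintegral mCD (integrableB mCD iF iG)) _.
  apply: (@le_trans _ _ (\int[Pr]_(w in D @^-1` C) (B%:R * `|f (D w) - g (D w)|))).
    apply: le_Rintegral => //.
    - exact: (integrable_abse (integrableB mCD iF iG)).
    - exact: (integrableZl mCD B%:R (ifg _ mCD)).
    - by move=> w _ /=; exact: below_prob_dist.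
  rewrite (RintegralZl _ mCD (ifg _ mCD)) ler_wpM2l//.
  apply: le_trans df; rewrite fine_le ?integrable_fin_num//.
  - exact: ifg.
  - exact: ifg.
  - apply: ge0_subset_integral => //; apply: (measurable_int Pr); exact: ifg.
move: dI dE; rewrite mulrDl mul1r !ler_norml => /andP[? ?] /andP[? ?].
by apply/andP; split; lra.
Unshelve. all: by end_near. Qed.

(** Grouping by cardinality j: there are 'C(B, j) sets, each contributing p^j (1 - p)^(B - j). *)
Lemma sum_below_prob (i k : nat) (p : R) :
  \sum_(I : {set 'I_B} | (i <= #|I| < k)%N) below_prob I p = binomial_window B i k p.
Proof.
transitivity (\sum_(i <= j < k) \sum_(I : {set 'I_B} | #|I| == j) below_prob I p).
  rewrite (exchange_big_dep xpredT)//= [LHS]big_mkcond/=; apply: eq_bigr => I _.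
  rewrite (eq_bigl (fun j => j == #|I|)) => [|j]; last by rewrite eq_sym.
  by rewrite big_nat1_eq.
apply: eq_bigr => j _.
rewrite (eq_bigr (fun=> XMonemX j (B - j) p)) => [|I /eqP <-]; last first.
  rewrite /below_prob (bigID (mem I))/= (eq_bigr (fun=> p)) => [|b ->//].
  rewrite [X in _ * X](eq_bigr (fun=> 1 - p)) => [|b /negbTE ->//].
  rewrite !prodr_const; congr (_ ^+ _ * _ ^+ _).
  have cI : B = (#|I| + #|[predC I]|)%N by rewrite cardC card_ord.
  by rewrite [X in (X - _)%N]cI addKn; apply: eq_card.
rewrite sumr_const mulr_natl; congr (_ *+ _).
have := card_draws 'I_B j; rewrite card_ord => <-.
by rewrite cardsE; apply: eq_card.
Qed.

Lemma measurable_below_pred s (Q : pred {set 'I_B}) : measurable_fun setT s ->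
  measurable [set w | Q (below s w)].
Proof.
move=> ms; rewrite (_ : [set _ | _] = \bigcup_(I in [set` Q]) [set w | below s w = I]).
  by apply: fin_bigcup_measurable => // I _; exact: measurable_below_eq.
by apply/seteqP; split => [w Qw|w [I QI /= ->]//]; exists (below s w).
Qed.

(** The conditional binomial law of the count: the event is the disjoint union over the sets [I] of
    admissible size, and [cond_iid_below] evaluates each piece. *)
Lemma cond_iid_card_below s (b : 'I_B) (f : S -> R) (i k : nat) (C : set S) :
  measurable_fun setT s ->
  is_cond_prob Pr D [set w | W b w <= s (D w)] f -> (forall x, 0 <= f x <= 1) ->
  measurable C ->
  \int[Pr]_(w in D @^-1` C) binomial_window B i k (f (D w)) =
    fine (Pr ([set w | (i <= #|below s w| < k)%N] `&` D @^-1` C)).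
Proof.
move=> ms fb f01 mC; have mf := fb.1; have mCD := measurable_preimage_D mC.
under eq_Rintegral do rewrite -sum_below_prob.
rewrite Rintegral_sum//; last first.
  move=> I; apply: (integrable_comp_D (f := below_prob I \o f)) => //.
    exact: measurable_below_prob.
  by move=> x; exact: below_prob01.
have indI w : \1_[set w | (i <= #|below s w| < k)%N] w =
    \sum_(I : {set 'I_B} | (i <= #|I| < k)%N) \1_[set w | below s w = I] w :> R.
  rewrite (eq_bigr (fun I => (below s w == I)%:R)) => [|I _]; last first.
    rewrite indicE; congr (nat_of_bool _)%:R.
    by apply/idP/eqP => [/set_mem|/mem_set].
  rewrite indicE big_mkcond (bigD1 (below s w))//= big1 => [|I nI].
    rewrite eqxx addr0 -mulrb; congr (nat_of_bool _)%:R.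
    by apply/idP/idP => [/set_mem|/mem_set].
  by rewrite eq_sym (negbTE nI) if_same.
rewrite -Rintegral_indic//; last first.
  exact: (measurable_below_pred (fun I => (i <= #|I| < k)%N)).
under [RHS]eq_Rintegral do rewrite indI.
rewrite Rintegral_sum//; last first.
  move=> I; apply: integrable_le1 => //.
    by apply: measurable_indic; exact: measurable_below_eq.
  by move=> w; rewrite indicE normr_nat lern1; case: (_ \in _).
apply: eq_bigr => I _; rewrite Rintegral_indic//; last exact: measurable_below_eq.
exact: (fine_cond_prob (cond_iid_below ms fb f01 I) mC).
Qed.

End threshold.

End conditional_probability.

(** * Order statistics and indices *)

Section order_statistics.
Context (R : realType) (B : nat).
Implicit Types (w : B.-tuple R) (x : R).

(** The i-th entry of a sorted list is at most [x] exactly when at least i entries are. For i = 0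
    the count condition is void and the convention [wbot] decides. *)
Lemma order_stat_le (wbot wtop : \bar R) w x i : (i <= B)%N ->
  (order_stat wbot wtop w i <= x%:E)%E =
  (i <= count (<= x)%R w)%N && ((i == 0%N) ==> (wbot <= x%:E)%E).
Proof.
case: i => [|i] iB; first by [].
rewrite /order_stat /= andbT (nth_map 0) ?size_sort ?size_tuple// lee_fin.
have ss : sorted <=%R (sort <=%R w) by exact: sort_le_sorted.
have <- : count (<= x)%R (sort <=%R w) = count (<= x)%R w.
  by apply/permP; rewrite perm_sort.
have [ic|ci] := ltnP; first exact: nth_count_le.
by apply/negbTE; rewrite -ltNge nth_count_gt// ci size_sort size_tuple.
Qed.

(** Dually, for k = B + 1 the count condition always holds and the convention [wtop] decides. *)
Lemma lt_order_stat (wbot wtop : \bar R) w x k : (0 < k <= B.+1)%N ->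
  (x%:E < order_stat wbot wtop w k)%E =
  (count (<= x)%R w < k)%N && ((k == B.+1) ==> (x%:E < wtop)%E).
Proof.
case: k => // k; rewrite /order_stat /= ltnS eqSS.
rewrite leq_eqVlt => /predU1P[->|kB].
  rewrite eqxx /= nth_default ?size_map ?size_sort ?size_tuple//.
  by rewrite ltnS -[X in (_ <= X)%N](size_tuple w) count_size.
rewrite (ltn_eqF kB) andbT (nth_map 0) ?size_sort ?size_tuple// lte_fin.
have ss : sorted <=%R (sort <=%R w) by exact: sort_le_sorted.
have <- : count (<= x)%R (sort <=%R w) = count (<= x)%R w.
  by apply/permP; rewrite perm_sort.
rewrite ltnS; have [ck|kc] := leqP.
  by rewrite nth_count_gt// ck size_sort size_tuple.
by apply/negbTE; rewrite -leNgt nth_count_le.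
Qed.

End order_statistics.

(** * Bounds on the indices of the confidence interval *)

Section ci_indices.
Context (R : realType) (B : nat) (alpha : R).
Hypotheses (alpha_gt0 : 0 < alpha) (alpha_lt1 : alpha < 1).
Let i := ci_lower_index B alpha.
Let c := ci_width B alpha.

Lemma ci_widthE : (Num.ceil (B.+1%:R * (1 - alpha)))%:~R = c%:R :> R.
Proof.
rewrite /c /ci_width [RHS]pmulrn gez0_abs// -(ler_int R).
rewrite (le_trans _ (ceil_ge _))//.
by rewrite mulr_ge0// subr_ge0 ltW.
Qed.

Lemma ci_width_itv : B.+1%:R * (1 - alpha) <= c%:R < B.+1%:R * (1 - alpha) + 1.
Proof.
rewrite -ci_widthE ceil_ge/= -ltrBlDr.
by have := ceilB1_lt (B.+1%:R * (1 - alpha)); rewrite intrB.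
Qed.

Lemma ci_lower_index_le : i%:R <= B.+1%:R * (alpha / 2).
Proof.
rewrite /i /ci_lower_index [leLHS]pmulrn gez0_abs ?floor_le//.
by rewrite floor_ge0 mulr_ge0// divr_ge0// ltW.
Qed.

Lemma ci_width_gt0 : (0 < c)%N.
Proof.
rewrite -(ltr_nat R); have /andP[+ _] := ci_width_itv; apply: lt_le_trans.
by rewrite mulr_gt0// subr_gt0.
Qed.

(** c + i < (B + 1)(1 - alpha) + 1 + (B + 1) alpha/2 < B + 2. *)
Lemma ci_upper_index_le : (c + i <= B.+1)%N.
Proof.
rewrite -ltnS -(ltr_nat R) natrD -[X in _ < X]natr1.
have /andP[_ h] := ci_width_itv; have h' := ci_lower_index_le.
have : 0 < B.+1%:R * alpha by rewrite mulr_gt0.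
rewrite mulrA in h'; rewrite mulrBr mulr1 in h; lra.
Qed.

End ci_indices.

(** * Coverage *)

Section unit_interval_window.
Context (R : realType) (n i k : nat) (ikn : (i < k <= n.+1)%N).

(** For [A] inside [0, 1], extension by zero gives a quasi-concave function on the whole line with
    values in [0, 1], as [quasiconcave_dKS] requires. *)
Definition window_on (A : interval R) (x : R) : R :=
  if x \in A then binomial_window n i k x else 0.

Lemma window_on01 A x : (A <= `[0%R, 1%R])%O -> 0 <= window_on A x <= 1.
Proof.
move=> A01; rewrite /window_on; case: ifPn => [xA|_]; last by rewrite lexx ler01.
have x01 : x \in `[0, 1] by exact: subitvP xA.
rewrite binomial_window_ge0// binomial_window_le1//.
by case/andP: ikn => /ltnW -> ->.
Qed.

Lemma measurable_window_on A : measurable_fun setT (window_on A).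
Proof.
rewrite (_ : window_on A = binomial_window n i k \* \1_[set` A]).
  apply: measurable_funM; first exact: measurable_binomial_window.
  by apply: measurable_indic; exact: measurable_itv.
apply/funext => x; rewrite /window_on /= indicE; case: ifPn => xA.
  by rewrite mem_set// mulr1.
by rewrite memNset ?mulr0//; exact/negP.
Qed.

Lemma window_on_quasiconcave A x y z : (A <= `[0%R, 1%R])%O -> x <= z <= y ->
  Num.min (window_on A x) (window_on A y) <= window_on A z.
Proof.
move=> A01 xzy; have /andP[z0 _] := window_on01 z A01.
have [xA|xA] := boolP (x \in A); last first.
  by rewrite [window_on A x]/window_on (negbTE xA) ge_min z0.
have [yA|yA] := boolP (y \in A); last first.
  by rewrite [window_on A y]/window_on (negbTE yA) ge_min z0 orbT.
have zA : z \in A by exact: (interval_is_interval xA yA).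
rewrite /window_on xA yA zA; apply: binomial_window_quasiconcave => //.
- by case/andP: ikn.
- exact: subitvP xA.
- exact: subitvP yA.
Qed.

(** [A] differs from [0, 1] at most in the endpoints, which are Lebesgue-null. *)
Lemma integral_window_on A : (`]0%R, 1%R[ <= A)%O -> (A <= `[0%R, 1%R])%O ->
  \int[uniform_prob (@ltr01 R)]_u window_on A u = (k - i)%:R / n.+1%:R.
Proof.
move=> A0 A01; have mG := measurable_window_on A.
have G01 x := window_on01 x A01.
rewrite -integral_binomial_window; last by case/andP: ikn => /ltnW -> ->.
rewrite [LHS]/Rintegral integral_uniform; last 2 first.
- exact/measurable_EFinP.
- by move=> x; rewrite lee_fin; case/andP: (G01 x).
rewrite subr0 invr1 mul1e.
have oo (f : R -> R) : measurable_fun setT f -> (forall x, 0 <= f x <= 1) ->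
    \int[lebesgue_measure]_(x in `[0, 1]) f x =
    \int[lebesgue_measure]_(x in `]0, 1[) f x.
  move=> mf f01.
  have if' (a b : bool) : lebesgue_measure.-integrable
      [set` Interval (BSide a (0 : R)) (BSide b 1)] (EFin \o f).
    apply: measurable_bounded_integrable.
    - exact: measurable_itv.
    - by rewrite /= lebesgue_measure_itv/= lte_fin ltr01 -EFinD ltry.
    - exact: measurable_funTS.
    - exists 1; split => // r r1 x _ /=; have /andP[f0 f1] := f01 x.
      by rewrite ger0_norm// (le_trans f1)// ltW.
  by rewrite -Rintegral_itv_obnd_cbnd// -Rintegral_itv_bndo_bndc.
transitivity (\int[lebesgue_measure]_(x in `[0, 1]) window_on `[0%R, 1%R] x).
  change (Rintegral lebesgue_measure `[0, 1] (window_on A) =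
    Rintegral lebesgue_measure `[0, 1] (window_on `[0%R, 1%R])).
  rewrite (oo (window_on A))// (oo (window_on _))//; last 2 first.
  - exact: measurable_window_on.
  - by move=> x; exact: window_on01.
  apply: eq_Rintegral => x /set_mem /= x01.
  by rewrite /window_on (subitvP A0 x01) (subitvP _ x01)// (le_trans A0).
by apply: eq_Rintegral => x /set_mem /= x01; rewrite /window_on x01.
Qed.

Lemma window_on_dKS A d (O : measurableType d) (P : probability O R) (Y : O -> R) :
  (`]0%R, 1%R[ <= A)%O -> (A <= `[0%R, 1%R])%O -> measurable_fun setT Y ->
  `|\int[P]_w window_on A (Y w) - (k - i)%:R / n.+1%:R| <= dKS_uniform P Y.
Proof.
move=> A0 A01 mY; rewrite -(integral_window_on A0 A01); apply: quasiconcave_dKS => //.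
- exact: measurable_window_on.
- by move=> x; exact: window_on01.
- by move=> x y z; exact: window_on_quasiconcave.
Qed.

End unit_interval_window.

Theorem corollary2
  (R : realType)
  (dO : measure_display) (O : measurableType dO) (Pr : probability O R)
  (dT : measure_display) (T : measurableType dT) (P : probability T R)
  (X : nat -> {RV Pr >-> T}) (X_iid : iid_from P X)
  (p : nat) (phi : probability T R -> 'rV[R]_p)
  (S : 'rV[R]_p -> R) (tau : nat -> R)
  (root_meas : forall (n : nat) (n_gt0 : (0 < n)%N),
     measurable_fun setT
       (fun x : n.-tuple T => root_stat phi S tau n_gt0 x (phi P)))
  (root_cvg : cvg_in_distribution Pr (fun n w =>
     root_stat phi S tau (ltn0Sn n) [tuple X i w | i < n.+1] (phi P)))
  (m k B : nat) (m_gt0 : (0 < m)%N) (k_gt0 : (0 < k)%N)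
  (D : O -> m.-tuple T) (D_def : D = fun w => [tuple X i w | i < m])
  (J : 'I_B -> O -> k.-tuple 'I_m)
  (W : 'I_B -> O -> R)
  (W_def : W = fun b w => subsample_stat phi S tau m_gt0 k_gt0 (D w) (J b w))
  (W_meas : forall b, measurable_fun setT (W b))
  (W_cond_iid : cond_iid Pr D W)
  (WW : set R) (W_in_WW : forall b w, WW (W b w))
  (wtop : \bar R) (WW_le_wtop : forall v, WW v -> (v%:E <= wtop)%E)
  (alpha : R) (alpha_gt0 : 0 < alpha) (alpha_lt1 : alpha < 1)
  (b : 'I_B) (F0 : m.-tuple T -> R)
  (F0_def : is_cond_prob Pr D
     [set w : O | W b w <= root_stat phi S tau m_gt0 (D w) (phi P)] F0) :
  let coverage := fine (Pr [set w : O |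
    subsampling_ci alpha WW wtop [tuple W i w | i < B]
      (root_stat phi S tau m_gt0 (D w)) (phi P)]) in
  let delta := dKS_uniform Pr (F0 \o D) in
  `|coverage - (Num.ceil (B.+1%:R * (1 - alpha)))%:~R / B.+1%:R| <= delta /\
  - delta <= coverage - (1 - alpha) <= B.+1%:R^-1 + delta.
Proof.
move=> coverage delta.
pose s x := root_stat phi S tau m_gt0 x (phi P).
have ms : measurable_fun setT s by exact: root_meas.
have mD : measurable_fun setT D.
  rewrite D_def; apply/measurable_fun_tnthP => i.
  by rewrite (_ : _ \o _ = X i)//; apply/funext => w /=; rewrite tnth_mktuple.
have mDC (C : set (m.-tuple T)) : measurable C -> measurable (D @^-1` C).
  exact: measurable_preimage_D.
pose i := ci_lower_index B alpha; pose c := ci_width B alpha.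
have c0 : (0 < c)%N by exact: ci_width_gt0.
have cB : (c + i <= B.+1)%N by exact: ci_upper_index_le.
have mb : measurable [set w | W b w <= s (D w)] by exact: measurable_below.
(* [F0] is an arbitrary version, so conditional laws are computed with its clipped form; [delta]
   involves [F0] itself, to which [cov_le] and [cov_ge] return. *)
pose F := @clip01 R \o F0.
have F01 x : 0 <= F x <= 1 by exact: clip01_itv.
have Fb : is_cond_prob Pr D [set w | W b w <= s (D w)] F.
  exact: is_cond_prob_clip.
have mF : measurable_fun setT F := Fb.1.
have mF0 : measurable_fun setT F0 := F0_def.1.
pose win := [set w | (i <= #|below D W s w| < c + i)%N].
have mwin : measurable win.
  exact: (measurable_below_pred mD W_meas (fun I => (i <= #|I| < c + i)%N)).
have winE C : measurable C -> \int[Pr]_(w in D @^-1` C)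
    binomial_window B i (c + i) (F (D w)) = fine (Pr (win `&` D @^-1` C)).
  by move=> mC; exact: (cond_iid_card_below mD W_meas W_cond_iid _ _ ms Fb F01 mC).
pose lo := [set x | ((s x)%:E < ereal_inf [set v%:E | v in WW])%E].
pose hi := [set x | (wtop <= (s x)%:E)%E].
(* The data for which the convention for W_(0) or W_(B+1) excludes theta_0 whatever the count is. *)
pose bad : set (m.-tuple T) := [set x |
  (i == 0%N) && ((s x)%:E < ereal_inf [set v%:E | v in WW])%E ||
  (c + i == B.+1)%N && (wtop <= (s x)%:E)%E].
have mEs : measurable_fun setT (EFin \o s) by exact/measurable_EFinP.
have mlo : measurable lo.
  rewrite (_ : lo = setT `&` (EFin \o s) @^-1`
      [set` `]-oo, ereal_inf [set v%:E | v in WW][]).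
    by apply: mEs => //; exact: emeasurable_itv.
  by apply/seteqP; split => x; rewrite /lo/= in_itv/=; [move=> ?|case].
have mhi : measurable hi.
  rewrite (_ : hi = setT `&` (EFin \o s) @^-1` [set` `[wtop, +oo[]).
    by apply: mEs => //; exact: emeasurable_itv.
  by apply/seteqP; split => x; rewrite /hi/= in_itv/= andbT; [move=> ?|case].
have mbad : measurable bad.
  rewrite (_ : bad = (if i == 0%N then lo else set0) `|`
      (if (c + i == B.+1)%N then hi else set0)).
    by apply: measurableU; case: ifP.
  apply/seteqP; split => x; rewrite /bad /lo /hi/=.
    by move=> /orP[] /andP[-> ?]; [left|right].
  by case: eqP => _; case: eqP => _ //= -[]// ->; rewrite ?orbT.
have cnt w : count (<= s (D w))%R [tuple W i w | i < B] = #|below D W s w|.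
  rewrite /= count_map cardE [in RHS]/enum_mem size_filter -enumT.
  by apply: eq_count => b'; rewrite /= inE.
pose cov := [set w | subsampling_ci alpha WW wtop [tuple W i w | i < B]
      (root_stat phi S tau m_gt0 (D w)) (phi P)].
have covE : cov = win `&` D @^-1` (~` bad).
  apply/funext => w; apply/propext.
  rewrite /cov /subsampling_ci /win /bad /=.
  rewrite order_stat_le; last by rewrite -ltnS (leq_trans _ cB)// -add1n leq_add2r.
  rewrite lt_order_stat; last by rewrite addn_gt0 c0.
  rewrite cnt; set lo_ := (_ <= _)%E; set hi_ := (_ < _)%E.
  have -> : ((s (D w))%:E < ereal_inf [set v%:E | v in WW])%E = ~~ lo_ by rewrite ltNge.
  have -> : (wtop <= (s (D w))%:E)%E = ~~ hi_ by rewrite leNgt.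
  have taut (a1 a2 e1 e2 l1 l2 : bool) : (a1 && (e1 ==> l1)) && (a2 && (e2 ==> l2)) <->
      a1 && a2 /\ ~ (e1 && ~~ l1 || e2 && ~~ l2).
    by case: a1; case: a2; case: e1; case: e2; case: l1; case: l2;
      split => // -[] // _ /(_ isT).
  exact: taut.
have mcov : measurable cov.
  by rewrite covE; apply: measurableI => //; apply: mDC; exact: measurableC.
pose C01 := [set x | 0 < F x < 1].
have mC01 : measurable C01.
  rewrite -[C01]setTI; apply: measurable_and => //;
    exact: measurable_fun_ltr.
(* On [lo] the statistic lies below all of [WW], so W_b <= s is impossible there and F(D) integrates
   to zero, although F > 0 on [C01]. *)
have lo0 : Pr (D @^-1` (lo `&` C01)) = 0%E.
  have mE : measurable (lo `&` C01) by exact: measurableI.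
  apply: (@gt0_integral_eq0 _ _ _ _ _ (F \o D)) => //.
  - exact: mDC.
  - by apply: measurable_funTS; exact: measurableT_comp.
  - by move=> w [_ /andP[]].
  - rewrite /= Fb.2// (_ : _ `&` _ = set0) ?measure0//.
    apply/seteqP; split => // w [/= Ws [+ _]].
    rewrite /lo/= ltNge => /negP; apply.
    by rewrite (@le_trans _ _ (W b w)%:E) ?lee_fin// ereal_inf_lbound//; exists (W b w).
(* On [hi] every value in [WW] is at most s, so the complementary event is impossible; the same
   argument applies to 1 - F. *)
have hi0 : Pr (D @^-1` (hi `&` C01)) = 0%E.
  have mE : measurable (hi `&` C01) by exact: measurableI.
  have Fb' := is_cond_probC mD mb Fb F01.
  apply: (@gt0_integral_eq0 _ _ _ _ _ ((fun x => 1 - F x) \o D)) => //.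
  - exact: mDC.
  - by apply: measurable_funTS; apply: measurableT_comp => //; exact: Fb'.1.
  - by move=> w [_ /andP[_ ?]] /=; rewrite subr_gt0.
  - rewrite /= Fb'.2// (_ : _ `&` _ = set0) ?measure0//.
    apply/seteqP; split => // w [/= Ws [+ _]]; apply: contra_not Ws.
    by rewrite /hi/= => ws; rewrite -lee_fin (le_trans _ ws)// WW_le_wtop.
have fcov : fine (Pr cov) = coverage by [].
(* Coverage implies that the count lies in the window, and [F0] agrees with its clipped form almost
   surely. *)
have cov_le : coverage <= \int[Pr]_w window_on B i (c + i) `[0%R, 1%R] ((F0 \o D) w).
  have [N [mN N0] FN] := is_cond_prob_ae01 mD mb F0_def.
  have -> : \int[Pr]_w window_on B i (c + i) `[0%R, 1%R] ((F0 \o D) w) =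
      \int[Pr]_(w in D @^-1` setT) binomial_window B i (c + i) (F (D w)).
    rewrite preimage_setT; congr fine; apply: ae_eq_integral => //.
    - apply/measurable_EFinP/measurableT_comp; last exact: measurableT_comp.
      exact: measurable_window_on.
    - apply/measurable_EFinP/measurableT_comp; last exact: measurableT_comp.
      exact: measurable_binomial_window.
    - exists N; split => // w /= h; apply: contrapT => /FN f01; apply: h => _.
      by rewrite /window_on in_itv/= f01 /F /= clip01_id.
  rewrite winE// preimage_setT setIT -fcov fine_le ?fin_num_measure//.
  by rewrite le_measure ?inE// covE; exact: subIsetl.
(* Where 0 < F < 1, a count in the window implies coverage up to the two null events above. Clipping
   does not affect membership in ]0, 1[. *)
have cov_ge : \int[Pr]_w window_on B i (c + i) `]0%R, 1%R[ ((F0 \o D) w) <= coverage.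
  have -> : \int[Pr]_w window_on B i (c + i) `]0%R, 1%R[ ((F0 \o D) w) =
      \int[Pr]_(w in D @^-1` C01) binomial_window B i (c + i) (F (D w)).
    rewrite [RHS]Rintegral_mkcond; apply: eq_Rintegral => w _.
    rewrite patchE /window_on in_itv/=.
    have -> : (w \in D @^-1` C01) = (0 < F0 (D w) < 1).
      apply/idP/idP => [/set_mem|h].
        rewrite /C01/= /F/= /clip01 lt_max ltxx/= lt_min ltr01 andbT => /andP[f0].
        by rewrite f0 gt_max ltr01/= gt_min ltxx orbF.
      apply/mem_set; rewrite /C01/= /F/= clip01_id//.
      by case/andP: h => /ltW -> /ltW ->.
    by case: ifP => // /andP[f0 f1]; rewrite /F/= clip01_id// !ltW.
  have mZ : measurable (D @^-1` (lo `&` C01) `|` D @^-1` (hi `&` C01)).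
    by apply: measurableU; apply: mDC; exact: measurableI.
  rewrite winE// -fcov fine_le ?fin_num_measure//.
    by apply: measurableI => //; exact: mDC.
  apply: (@le_trans _ _ (Pr (cov `|` (D @^-1` (lo `&` C01) `|` D @^-1` (hi `&` C01))))).
    rewrite le_measure ?inE//; last first.
    - rewrite covE => w [winw Cw]; have [bw|nbw] := pselect (bad (D w)).
        by move: bw => /orP[] /andP[_ ?]; right; [left|right].
      by left.
    - exact: measurableU.
    - by apply: measurableI => //; exact: mDC.
  rewrite (le_trans (measureU2 Pr mcov mZ))// -[leRHS]adde0 leeD2l//.
  have mlo' : measurable (D @^-1` (lo `&` C01)) by apply: mDC; exact: measurableI.
  have mhi' : measurable (D @^-1` (hi `&` C01)) by apply: mDC; exact: measurableI.
  by rewrite (le_trans (measureU2 Pr mlo' mhi'))// [leLHS]/= lo0 hi0 adde0.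
have ikn : (i < c + i <= B.+1)%N by rewrite cB andbT -addn1 addnC leq_add2r.
have mF0D : measurable_fun setT (F0 \o D) by exact: measurableT_comp.
have oocc : (`]0%R, 1%R[ <= `[0%R, 1%R] :> interval R)%O by rewrite /Order.le/= !bnd_simp.
(* The closed interval supplies the upper bound on coverage and the open one the lower bound; both
   windows have the uniform integral c/(B + 1). *)
have := window_on_dKS ikn Pr oocc (lexx _) mF0D.
have := window_on_dKS ikn Pr (lexx _) oocc mF0D.
rewrite addnK ci_widthE// -/c -/delta !ler_distl => /andP[lo1 _] /andP[_ hi1].
have /andP[c1 c2] := ci_width_itv B alpha_lt1.
rewrite -/c in c1 c2.
have B0 : 0 < B.+1%:R :> R by rewrite ltr0n.
have d1 : 1 - alpha <= c%:R / B.+1%:R by rewrite ler_pdivlMr// mulrC.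
have d2 : c%:R / B.+1%:R <= 1 - alpha + B.+1%:R^-1.
  by rewrite ler_pdivrMr// mulrDl mulVf ?lt0r_neq0// mulrC ltW.
have cov_lo := le_trans lo1 cov_ge; have cov_hi := le_trans cov_le hi1.
split; first by apply/andP; split; [exact: cov_lo|exact: cov_hi].
apply/andP; split.
  by rewrite lerBrDr addrC (le_trans _ cov_lo)// lerD2r.
by rewrite lerBlDr addrAC (le_trans cov_hi)// lerD2r addrC.
Qed.
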